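(* Consider the RMAC scheme for the time-dependent Stokes equations with viscosity $\mu>0$ and homogeneous boundary condition (defined in the context). The local mass conservation law holds for the scheme: $d_xW^{x,n}_{i+1/2,j+1/2}+d_yW^{y,n}_{i+1/2,j+1/2}=0$ on every cell. Additionally, in the absence of the extra force ($\mathbf g=0$), the solutions of the scheme satisfy, for every $n\ge1$, the discrete unconditional energy dissipation law $$\tfrac12\|\mathbf W^n\|^2-\tfrac12\|\mathbf W^{n-1}\|^2\le-\Delta t\,\mu\,\|D\mathbf W^n\|^2\le0.$$ If, in addition, there is a strictly interior subdomain $\hat\Omega\subset[x_1,x_{N_x-1}]\times[y_1,y_{N_y-1}]$ such that $\mathbf W$ and $Z$ vanish on $\Omega\setminus\hat\Omega$, then the solutions satisfy momentum conservation $$(\mathbf W^n,\mathbf e_i)=(\mathbf W^{n-1},\mathbf e_i),\qquad i=1,2,$$ and angular momentum conservation $$(\mathbf W^n,\hat{\mathbf x})=(\mathbf W^{n-1},\hat{\mathbf x}),$$ where $\mathbf e_1,\mathbf e_2$ are the unit coordinate vectors in the $x$- and $y$-directions and $\hat{\mathbf x}=(y,-x)$.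
   Context: Grid. $\Omega=(0,L_x)\times(0,L_y)$, $\Delta t=T/N$, $t^n=n\Delta t$. Partitions $0=x_0<\dots<x_{N_x}=L_x$, $0=y_0<\dots<y_{N_y}=L_y$; $x_{i-1/2},y_{j-1/2}$ midpoints, $h_{i-1/2}=x_i-x_{i-1}$, $k_{j-1/2}=y_j-y_{j-1}$; $h_i=(h_{i+1/2}+h_{i-1/2})/2$ for $1\le i\le N_x-1$, $h_0=h_{1/2}/2$, $h_{N_x}=h_{N_x-1/2}/2$; similarly $k_j$, $k_0$, $k_{N_y}$. Partitions are regular: $\min_{i,j}\{h_{i+1/2},k_{j+1/2}\}\ge C_0\max_{i,j}\{h_{i+1/2},k_{j+1/2}\}$ for a constant $C_0>0$. Difference operators. $[d_x\phi]_{i+1/2,m}=(\phi_{i+1,m}-\phi_{i,m})/h_{i+1/2}$, $[d_y\phi]_{l,j+1/2}=(\phi_{l,j+1}-\phi_{l,j})/k_{j+1/2}$, $[D_x\phi]_{i,m}=(\phi_{i+1/2,m}-\phi_{i-1/2,m})/h_{i}$, $[D_y\phi]_{l,j}=(\phi_{l,j+1/2}-\phi_{l,j-1/2})/k_{j}$, $[d_t\phi]^n=(\phi^n-\phi^{n-1})/\Delta t$; at the boundary $[D_y\phi]_{l,0}=(\phi_{l,1/2}-\phi_{l,0})/k_0$, $[D_y\phi]_{l,N_y}=(\phi_{l,N_y}-\phi_{l,N_y-1/2})/k_{N_y}$, and similarly for $D_x$. RMAC scheme. With $f^{x,n}_{i,j+1/2}=\frac1{h_i}\int_{x_{i-1/2}}^{x_{i+1/2}}g^x(x,y_{j+1/2},t^n)\,dx$,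 $f^{y,n}_{i+1/2,j}=\frac1{k_j}\int_{y_{j-1/2}}^{y_{j+1/2}}g^y(x_{i+1/2},y,t^n)\,dy$ for a force $\mathbf g=(g^x,g^y)$, the unknowns $\mathbf W^n=(W^{x,n},W^{y,n})$, $Z^n$ satisfy for $n\ge1$ $$d_tW^{x,n}_{i,j+1/2}-\mu D_x(d_xW^{x,n})_{i,j+1/2}-\mu d_y(D_yW^{x,n})_{i,j+1/2}+D_xZ^n_{i,j+1/2}=f^{x,n}_{i,j+1/2}\quad(1\le i\le N_x-1,\ 0\le j\le N_y-1),$$ $$d_tW^{y,n}_{i+1/2,j}-\mu d_x(D_xW^{y,n})_{i+1/2,j}-\mu D_y(d_yW^{y,n})_{i+1/2,j}+D_yZ^n_{i+1/2,j}=f^{y,n}_{i+1/2,j}\quad(0\le i\le N_x-1,\ 1\le j\le N_y-1),$$ $$d_xW^{x,n}_{i+1/2,j+1/2}+d_yW^{y,n}_{i+1/2,j+1/2}=0\quad(0\le i\le N_x-1,\ 0\le j\le N_y-1),$$ with $W^{x,n}_{0,j+1/2}=W^{x,n}_{N_x,j+1/2}=W^{x,n}_{i,0}=W^{x,n}_{i,N_y}=0$, $W^{y,n}_{0,j}=W^{y,n}_{N_x,j}=W^{y,n}_{i+1/2,0}=W^{y,n}_{i+1/2,N_y}=0$ for all $n\ge0$. The initial velocity $\mathbf W^0$ need not be zero here. Inner products and norms. $(f,g)_{l^2,T,M}=\sum_{i=1}^{N_x-1}\sum_{j=0}^{N_y-1}h_ik_{j+1/2}f_{i,j+1/2}g_{i,j+1/2}$;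 $(f,g)_{l^2,M,T}=\sum_{i=0}^{N_x-1}\sum_{j=1}^{N_y-1}h_{i+1/2}k_jf_{i+1/2,j}g_{i+1/2,j}$; $(\mathbf v,\mathbf w)=(v^x,w^x)_{l^2,T,M}+(v^y,w^y)_{l^2,M,T}$, $\|\mathbf v\|^2=(\mathbf v,\mathbf v)$, where $\mathbf e_i,\hat{\mathbf x}$ are evaluated at the respective nodes, so $(\mathbf W,\hat{\mathbf x})=\sum h_ik_{j+1/2}W^x_{i,j+1/2}y_{j+1/2}-\sum h_{i+1/2}k_jW^y_{i+1/2,j}x_{i+1/2}$. $\|D\mathbf v\|^2=\|d_xv^x\|_{l^2,M}^2+\|D_yv^x\|_{l^2,T_y}^2+\|D_xv^y\|_{l^2,T_x}^2+\|d_yv^y\|_{l^2,M}^2$ with $\|f\|_{l^2,M}^2=\sum_{i=0}^{N_x-1}\sum_{j=0}^{N_y-1}h_{i+1/2}k_{j+1/2}f_{i+1/2,j+1/2}^2$, $\|f\|_{l^2,T_x}^2=\sum_{i=0}^{N_x}\sum_{j=1}^{N_y-1}h_ik_jf_{i,j}^2$, $\|f\|_{l^2,T_y}^2=\sum_{i=1}^{N_x-1}\sum_{j=0}^{N_y}h_ik_jf_{i,j}^2$. Compact support. The assumption that $\mathbf W$ and $Z$ vanish on $\Omega\setminus\hat\Omega$ means on the grid, for all time levels: $W^{x,n}_{i,j+1/2}=0$ for $i\in\{0,1,N_x-1,N_x\}$ (all $j$); $W^{x,n}_{i,0}=W^{x,n}_{i,1/2}=W^{x,n}_{i,N_y-1/2}=W^{x,n}_{i,N_y}=0$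 (all $i$); $W^{y,n}_{0,j}=W^{y,n}_{1/2,j}=W^{y,n}_{N_x-1/2,j}=W^{y,n}_{N_x,j}=0$ (all $j$); $W^{y,n}_{i+1/2,j}=0$ for $j\in\{0,1,N_y-1,N_y\}$ (all $i$); and $Z^n=0$ on all cells adjacent to the boundary, i.e. $Z^n_{1/2,j+1/2}=Z^n_{N_x-1/2,j+1/2}=Z^n_{i+1/2,1/2}=Z^n_{i+1/2,N_y-1/2}=0$. *)

(* Defs.v *)
From mathcomp Require Import all_boot all_order all_algebra.
From mathcomp Require Import all_classical all_reals all_analysis.

Set Implicit Arguments.
Unset Strict Implicit.
Unset Printing Implicit Defensive.

Import Order.TTheory GRing.Theory Num.Theory.

Local Open Scope ring_scope.

(* Half-integer indices are doubled: the mathematical index i is encoded by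
   the natural number i.*2 and i + 1/2 by i.*2.+1 (so i - 1/2 is
   i.*2.-1 for 0 < i).  A grid function phi : nat -> nat -> R thus has
   phi_{i, j+1/2} = phi i.*2 j.*2.+1, phi_{i, 0} = phi i.*2 0, and so on. *)

(* A one-dimensional partition: only pt 0, ..., pt ncells are meaningful. *)
Record axis (R : Type) := Axis { ncells : nat; pt : nat -> R }.

Section Axis.
Variable R : realType.
Implicit Types (A : axis R) (u : nat -> R).

Definition partition_of A (L : R) : Prop :=
  [/\ pt A 0 = 0, pt A (ncells A) = L &
      forall i, (i < ncells A)%N -> pt A i < pt A i.+1].

(* x_i at i.*2, and the midpoint x_{i+1/2} at i.*2.+1. *)
Definition node A (p : nat) : R :=
  if odd p then (pt A p./2 + pt A p./2.+1) / 2 else pt A p./2.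

Definition cell A (i : nat) : R := pt A i.+1 - pt A i.

(* h_{i+1/2} at i.*2.+1; h_i at i.*2, halved at the two end points. *)
Definition width A (p : nat) : R :=
  if odd p then cell A p./2
  else if p == 0%N then cell A 0 / 2
  else if p == (ncells A).*2 then cell A (ncells A).-1 / 2
  else (cell A p./2 + cell A p./2.-1) / 2.

(* The operator d at a half-integer index (p odd). *)
Definition diff_mid A u (p : nat) : R := (u p.+1 - u p.-1) / width A p.

(* The operator D at an integer index (p even), one-sided at the end points. *)
Definition diff_node A u (p : nat) : R :=
  if p == 0%N then (u 1%N - u 0%N) / width A p
  else if p == (ncells A).*2 then (u p - u p.-1) / width A p
  else (u p.+1 - u p.-1) / width A p.

End Axis.

Section Grid.
Variable R : realType.
Variables X Y : axis R.

Local Notation gridfun := (nat -> nat -> R).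
Local Notation Nx := (ncells X).
Local Notation Ny := (ncells Y).
Implicit Types (phi f g : gridfun) (v w : gridfun * gridfun).

Definition mesh_sizes : seq R :=
  [seq width X i.*2.+1 | i <- iota 0 Nx] ++
  [seq width Y j.*2.+1 | j <- iota 0 Ny].

(* The start value width X 1 = h_{1/2} belongs to mesh_sizes when 0 < Nx. *)
Definition regular_mesh (C0 : R) : Prop :=
  C0 * \big[Num.max/width X 1]_(s <- mesh_sizes) s
    <= \big[Num.min/width X 1]_(s <- mesh_sizes) s.

Definition d_x phi : gridfun := fun p q => diff_mid X (phi^~ q) p.
Definition d_y phi : gridfun := fun p q => diff_mid Y (phi p) q.
Definition D_x phi : gridfun := fun p q => diff_node X (phi^~ q) p.
Definition D_y phi : gridfun := fun p q => diff_node Y (phi p) q.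

Definition d_t (dt : R) (phi : nat -> gridfun) (n : nat) : gridfun :=
  fun p q => (phi n p q - phi n.-1 p q) / dt.

Definition inner_TM f g : R :=
  \sum_(1 <= i < Nx) \sum_(0 <= j < Ny)
    width X i.*2 * width Y j.*2.+1 * f i.*2 j.*2.+1 * g i.*2 j.*2.+1.

Definition inner_MT f g : R :=
  \sum_(0 <= i < Nx) \sum_(1 <= j < Ny)
    width X i.*2.+1 * width Y j.*2 * f i.*2.+1 j.*2 * g i.*2.+1 j.*2.

Definition inner v w : R := inner_TM v.1 w.1 + inner_MT v.2 w.2.

Definition normsq v : R := inner v v.

Definition normsq_M f : R :=
  \sum_(0 <= i < Nx) \sum_(0 <= j < Ny)
    width X i.*2.+1 * width Y j.*2.+1 * f i.*2.+1 j.*2.+1 ^+ 2.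

Definition normsq_Tx f : R :=
  \sum_(0 <= i < Nx.+1) \sum_(1 <= j < Ny)
    width X i.*2 * width Y j.*2 * f i.*2 j.*2 ^+ 2.

Definition normsq_Ty f : R :=
  \sum_(1 <= i < Nx) \sum_(0 <= j < Ny.+1)
    width X i.*2 * width Y j.*2 * f i.*2 j.*2 ^+ 2.

Definition normsq_D v : R :=
  normsq_M (d_x v.1) + normsq_Ty (D_y v.1)
  + normsq_Tx (D_x v.2) + normsq_M (d_y v.2).

Definition e1 : gridfun * gridfun := (fun _ _ => 1, fun _ _ => 0).
Definition e2 : gridfun * gridfun := (fun _ _ => 0, fun _ _ => 1).
Definition xhat : gridfun * gridfun :=
  (fun _ q => node Y q, fun p _ => - node X p).

Section Scheme.
Variables (mu dt : R) (N : nat).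
(* The two components of the force, as functions of x, y, t. *)
Variables gx gy : R -> R -> R -> R.
Variables (Wx Wy Z : nat -> gridfun).

Definition force_x (n : nat) : gridfun := fun p q =>
  (\int[lebesgue_measure]_(s in `[node X p.-1, node X p.+1])
     gx s (node Y q) (n%:R * dt)) / width X p.

Definition force_y (n : nat) : gridfun := fun p q =>
  (\int[lebesgue_measure]_(s in `[node Y q.-1, node Y q.+1])
     gy (node X p) s (n%:R * dt)) / width Y q.

Definition momentum_x_eq (n p q : nat) : Prop :=
  d_t dt Wx n p q - mu * D_x (d_x (Wx n)) p q - mu * d_y (D_y (Wx n)) p q
  + D_x (Z n) p q = force_x n p q.

Definition momentum_y_eq (n p q : nat) : Prop :=
  d_t dt Wy n p q - mu * d_x (D_x (Wy n)) p q - mu * D_y (d_y (Wy n)) p q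
  + D_y (Z n) p q = force_y n p q.

Definition mass_eq (n p q : nat) : Prop :=
  d_x (Wx n) p q + d_y (Wy n) p q = 0.

Definition no_slip (n : nat) : Prop :=
  [/\ forall j, (j < Ny)%N ->
        Wx n 0%N j.*2.+1 = 0 /\ Wx n Nx.*2 j.*2.+1 = 0,
      forall i, (i <= Nx)%N ->
        Wx n i.*2 0%N = 0 /\ Wx n i.*2 Ny.*2 = 0,
      forall j, (j <= Ny)%N ->
        Wy n 0%N j.*2 = 0 /\ Wy n Nx.*2 j.*2 = 0 &
      forall i, (i < Nx)%N ->
        Wy n i.*2.+1 0%N = 0 /\ Wy n i.*2.+1 Ny.*2 = 0].

Definition RMAC_solution : Prop :=
  [/\ forall n i j, (1 <= n <= N)%N -> (1 <= i < Nx)%N -> (j < Ny)%N ->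
        momentum_x_eq n i.*2 j.*2.+1,
      forall n i j, (1 <= n <= N)%N -> (i < Nx)%N -> (1 <= j < Ny)%N ->
        momentum_y_eq n i.*2.+1 j.*2,
      forall n i j, (1 <= n <= N)%N -> (i < Nx)%N -> (j < Ny)%N ->
        mass_eq n i.*2.+1 j.*2.+1 &
      forall n, (n <= N)%N -> no_slip n].

Definition compact_Wx (n : nat) : Prop :=
  (forall i j, i \in [:: 0; 1; Nx.-1; Nx]%N -> (j < Ny)%N ->
     Wx n i.*2 j.*2.+1 = 0) /\
  (forall i q, (i <= Nx)%N -> q \in [:: 0; 1; Ny.*2.-1; Ny.*2]%N ->
     Wx n i.*2 q = 0).

Definition compact_Wy (n : nat) : Prop :=
  (forall p j, p \in [:: 0; 1; Nx.*2.-1; Nx.*2]%N -> (j <= Ny)%N ->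
     Wy n p j.*2 = 0) /\
  (forall i j, (i < Nx)%N -> j \in [:: 0; 1; Ny.-1; Ny]%N ->
     Wy n i.*2.+1 j.*2 = 0).

Definition compact_Z (n : nat) : Prop :=
  (forall p j, p \in [:: 1; Nx.*2.-1]%N -> (j < Ny)%N ->
     Z n p j.*2.+1 = 0) /\
  (forall i q, (i < Nx)%N -> q \in [:: 1; Ny.*2.-1]%N ->
     Z n i.*2.+1 q = 0).

(* The scheme involves the pressure only at the levels n >= 1. *)
Definition compact_support : Prop :=
  (forall n, (n <= N)%N -> compact_Wx n /\ compact_Wy n) /\
  (forall n, (1 <= n <= N)%N -> compact_Z n).

End Scheme.
End Grid.

Definition no_force (R : realType) (Lx Ly T : R) (gx gy : R -> R -> R -> R) :
    Prop :=
  forall x y t, 0 < x < Lx -> 0 < y < Ly -> 0 < t <= T ->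
    gx x y t = 0 /\ gy x y t = 0.

(* Main.v *)
(* The y-component of the scheme is the x-component with the two axes exchanged,
   so everything is proved for the x-component.  Testing the momentum equation
   with a grid function phi and summing by parts in each direction moves the
   outer difference operators onto phi.  With phi = W^n the viscous terms become
   the dissipation, the pressure terms of the two components cancel by discrete
   incompressibility, and (a - b) a >= (a^2 - b^2) / 2 gives the energy law.
   With phi = 1 or phi = y all that remains are boundary terms, because the
   differences of the test function are 0, resp. 1; they vanish by the
   compact support hypothesis. *)
Require Import Defs.
From mathcomp Require Import all_boot all_order all_algebra.
From mathcomp Require Import all_classical all_reals all_analysis.
From mathcomp Require Import ring lra zify.
Import Order.TTheory GRing.Theory Num.Theory.
Local Open Scope ring_scope.

(** * Difference calculus on a one-dimensional partition *)

Section OneDimension.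
Variables (R : realType) (A : axis R) (L : R).
Hypotheses (L_gt0 : 0 < L) (partA : partition_of A L).
Implicit Types u w : nat -> R.

Local Notation n := (ncells A).

Lemma ncells_gt0 : (0 < n)%N.
Proof.
case: partA => A0 An _; rewrite lt0n; apply/eqP => n0.
by move: L_gt0; rewrite -An n0 A0 ltxx.
Qed.

Lemma cell_gt0 i : (i < n)%N -> 0 < cell A i.
Proof. by case: partA => _ _ ptS lti; rewrite subr_gt0 ptS. Qed.

Lemma width_mid i : width A i.*2.+1 = cell A i.
Proof. by rewrite /width /= odd_double /= uphalf_double. Qed.

Lemma width_left : width A 0 = cell A 0 / 2.
Proof. by []. Qed.

Lemma width_right : width A n.*2 = cell A n.-1 / 2.
Proof.
by rewrite /width odd_double double_eq0 (gtn_eqF ncells_gt0) eqxx.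
Qed.

Lemma width_node i : (0 < i < n)%N ->
  width A i.*2 = (cell A i + cell A i.-1) / 2.
Proof.
move=> /andP[i0 ilt]; rewrite /width odd_double double_eq0 (gtn_eqF i0).
by rewrite (inj_eq double_inj) (ltn_eqF ilt) doubleK.
Qed.

Lemma width_mid_gt0 i : (i < n)%N -> 0 < width A i.*2.+1.
Proof. by move=> ?; rewrite width_mid cell_gt0. Qed.

Lemma width_node_gt0 i : (i <= n)%N -> 0 < width A i.*2.
Proof.
have n0 := ncells_gt0.
case: i => [|i] lei; first by rewrite width_left divr_gt0 ?cell_gt0.
move: lei; rewrite leq_eqVlt => /predU1P[->|lti].
  by rewrite width_right divr_gt0 // cell_gt0 // prednK.
by rewrite width_node // divr_gt0 // addr_gt0 // cell_gt0 // ltnW.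
Qed.

Lemma width_diff_mid u i : (i < n)%N ->
  width A i.*2.+1 * diff_mid A u i.*2.+1 = u i.+1.*2 - u i.*2.
Proof.
by move=> lti; rewrite /diff_mid mulrC divfK // gt_eqF // width_mid_gt0.
Qed.

Lemma width_diff_node u i : (0 < i < n)%N ->
  width A i.*2 * diff_node A u i.*2 = u i.*2.+1 - u i.*2.-1.
Proof.
move=> /andP[i0 lti]; rewrite /diff_node double_eq0 (gtn_eqF i0).
rewrite (inj_eq double_inj) (ltn_eqF lti) mulrC divfK // gt_eqF //.
by rewrite width_node_gt0 // ltnW.
Qed.

Lemma width_diff_left u : width A 0 * diff_node A u 0 = u 1%N - u 0%N.
Proof.
rewrite /diff_node /= mulrC divfK // gt_eqF //.
exact: (@width_node_gt0 0%N).
Qed.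

Lemma width_diff_right u :
  width A n.*2 * diff_node A u n.*2 = u n.*2 - u n.*2.-1.
Proof.
rewrite /diff_node double_eq0 (gtn_eqF ncells_gt0) eqxx.
by rewrite mulrC divfK // gt_eqF // width_node_gt0.
Qed.

(** Each width cancels the denominator of its difference quotient, which leaves Abel summation. The
    end nodes are left out of the sum, so the boundary terms pair [u] at the outermost midpoints
    with [w] at the end points. *)
Lemma sum_by_parts_node u w :
  \sum_(1 <= i < n) width A i.*2 * diff_node A u i.*2 * w i.*2
  = u n.*2.-1 * w n.*2 - u 1%N * w 0%N
    - \sum_(0 <= i < n) width A i.*2.+1 * u i.*2.+1 * diff_mid A w i.*2.+1.
Proof.
under eq_big_nat => i lti do rewrite width_diff_node //.
under [in RHS]eq_big_nat => i /andP[_ lti] do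
  rewrite mulrAC width_diff_mid //.
(* No width is left, so the identity can be proved by induction on the number of cells. *)
case: n ncells_gt0 => // m _; elim: m => [|m IHm].
  by rewrite big_geq // big_nat1; ring.
rewrite big_nat_recr //= IHm [in RHS]big_nat_recr //=.
by rewrite !doubleS /=; ring.
Qed.

(** The dual Abel summation. The one-sided differences of [w] at the two end points supply the
    half-cell increments, so the boundary terms take both [u] and [w] at the end points. *)
Lemma sum_by_parts_mid u w :
  \sum_(0 <= i < n) width A i.*2.+1 * diff_mid A u i.*2.+1 * w i.*2.+1
  = u n.*2 * w n.*2 - u 0%N * w 0%N
    - \sum_(0 <= i < n.+1) width A i.*2 * u i.*2 * diff_node A w i.*2.
Proof.
under eq_big_nat => i /andP[_ lti] do rewrite width_diff_mid //.
under [in RHS]eq_bigr => i _ do rewrite mulrAC.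
have n0 := ncells_gt0.
rewrite big_nat_recr //= [in RHS]big_ltn // double0 width_diff_right.
rewrite width_diff_left.
under [in RHS]eq_big_nat => i lti do rewrite width_diff_node //.
case: n n0 => // m _; elim: m => [|m IHm].
  by rewrite [in RHS]big_geq // big_nat1 !doubleS /=; ring.
rewrite big_nat_recr //= IHm [in RHS]big_nat_recr //=.
by rewrite !doubleS /=; ring.
Qed.

Lemma diff_mid_cst c p : diff_mid A (fun=> c) p = 0.
Proof. by rewrite /diff_mid subrr mul0r. Qed.

Lemma diff_node_cst c p : diff_node A (fun=> c) p = 0.
Proof. by rewrite /diff_node !subrr !mul0r; do ?case: ifP => _. Qed.

Lemma node_mid i : node A i.*2.+1 = (pt A i + pt A i.+1) / 2.
Proof. by rewrite /node /= odd_double /= uphalf_double. Qed.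

Lemma node_double i : node A i.*2 = pt A i.
Proof. by rewrite /node odd_double doubleK. Qed.

(** Each nodal width is the distance between the two points differenced there; at the ends this is
    the halved width, the distance from end point to first midpoint. *)
Lemma diff_node_node i : (i <= n)%N -> diff_node A (node A) i.*2 = 1.
Proof.
move=> lei; have w0 := width_node_gt0 _ lei.
apply: (mulfI (lt0r_neq0 w0)); rewrite mulr1.
case: i lei {w0} => [|i] lei.
  rewrite double0 width_diff_left width_left.
  by rewrite (node_mid 0) (node_double 0) /cell; field.
move: lei; rewrite leq_eqVlt => /predU1P[->|lti].
  have n0 := ncells_gt0.
  rewrite width_diff_right width_right node_double.
  have -> : n.*2.-1 = n.-1.*2.+1 by lia.
  by rewrite node_mid /cell prednK //; field.
rewrite width_diff_node // width_node // node_mid doubleS /=.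
by rewrite node_mid /cell; field.
Qed.

(** The strict bounds put the sampling points of the force in the open domain, where [no_force]
    applies. *)
Lemma node_mid_itv i : (i < n)%N -> 0 < node A i.*2.+1 < L.
Proof.
case: partA => A0 An ptS lti.
have mono a b : (a <= b)%N -> (b <= n)%N -> pt A a <= pt A b.
  elim: b => [|b IHb]; first by rewrite leqn0 => /eqP->.
  rewrite leq_eqVlt => /predU1P[->//|leab] ltb.
  exact: le_trans (IHb leab (ltnW ltb)) (ltW (ptS _ ltb)).
have := mono 0%N i isT (ltnW lti); have := mono i.+1 n lti (leqnn n).
rewrite A0 An.
have := ptS _ lti; rewrite node_mid; lra.
Qed.

(** Meant for the pressure and for the flux [d_x v]: against a test function without differences,
    only their values in the two outermost cells survive summation by parts. *)
Lemma sum_diff_node u w :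
  u 1%N = 0 -> u n.*2.-1 = 0 -> (forall p, diff_mid A w p = 0) ->
  \sum_(1 <= i < n) width A i.*2 * diff_node A u i.*2 * w i.*2 = 0.
Proof.
move=> u1 un w0; rewrite sum_by_parts_node u1 un !mul0r subr0 big1 ?subr0 //.
by move=> i _; rewrite w0 mulr0.
Qed.

(** A telescoping sum, read off from summation by parts against the constant 1. *)
Lemma sum_width_diff_node u :
  \sum_(0 <= i < n.+1) width A i.*2 * diff_node A u i.*2 = u n.*2 - u 0%N.
Proof.
have := sum_by_parts_mid (fun=> 1) u.
rewrite big1 => [|i _]; last by rewrite diff_mid_cst mulr0 mul0r.
rewrite !mul1r => /esym/eqP; rewrite subr_eq0 => /eqP ->.
by apply: eq_bigr => i _; rewrite mulr1.
Qed.

(** Two zeros of [u] at each end kill the one-sided differences in the boundary terms. With a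
    constant slope [c] of [w], the remaining sum is [c] times a telescoping one, which vanishes as
    well. *)
Lemma sum_diff_mid_diff_node u w c :
  u 0%N = 0 -> u 1%N = 0 -> u n.*2.-1 = 0 -> u n.*2 = 0 ->
  (forall i, (i <= n)%N -> diff_node A w i.*2 = c) ->
  \sum_(0 <= i < n)
    width A i.*2.+1 * diff_mid A (diff_node A u) i.*2.+1 * w i.*2.+1 = 0.
Proof.
move=> u0 u1 un1 un wc; rewrite sum_by_parts_mid.
have D0 : diff_node A u 0 = 0 by rewrite /diff_node /= u0 u1 subrr mul0r.
have Dn : diff_node A u n.*2 = 0.
  rewrite /diff_node double_eq0 (gtn_eqF ncells_gt0) eqxx un un1.
  by rewrite subrr mul0r.
rewrite D0 Dn !mul0r subrr sub0r.
rewrite (_ : \sum_(0 <= i < n.+1) _ = (u n.*2 - u 0%N) * c).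
  by rewrite un u0 subrr mul0r oppr0.
rewrite -sum_width_diff_node mulr_suml.
by apply: eq_big_nat => i lei; rewrite wc.
Qed.

End OneDimension.

(** * Testing the momentum equation of the x-component *)

Section XComponent.
Variables (R : realType) (X Y : axis R) (Lx Ly : R).
Hypotheses (Lx_gt0 : 0 < Lx) (Ly_gt0 : 0 < Ly).
Hypotheses (partX : partition_of X Lx) (partY : partition_of Y Ly).
Implicit Types f g u phi : nat -> nat -> R.

Local Notation Nx := (ncells X).
Local Notation Ny := (ncells Y).

Lemma inner_TM_columns f g :
  inner_TM X Y f g = \sum_(0 <= j < Ny) width Y j.*2.+1 *
    \sum_(1 <= i < Nx) width X i.*2 * f i.*2 j.*2.+1 * g i.*2 j.*2.+1.
Proof.
rewrite /inner_TM exchange_big_nat; apply: eq_bigr => j _.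
by rewrite mulr_sumr; apply: eq_bigr => i _; ring.
Qed.

Lemma inner_TM_rows f g :
  inner_TM X Y f g = \sum_(1 <= i < Nx) width X i.*2 *
    \sum_(0 <= j < Ny) width Y j.*2.+1 * f i.*2 j.*2.+1 * g i.*2 j.*2.+1.
Proof.
apply: eq_bigr => i _.
by rewrite mulr_sumr; apply: eq_bigr => j _; ring.
Qed.

(** Summation by parts along each row; the boundary terms carry the zero boundary values of [phi].
    Here [u] is either [d_x v] or the pressure. *)
Lemma inner_TM_D_x u phi :
  (forall j, (j < Ny)%N ->
     phi 0%N j.*2.+1 = 0 /\ phi Nx.*2 j.*2.+1 = 0) ->
  inner_TM X Y (D_x X u) phi =
  - \sum_(0 <= i < Nx) \sum_(0 <= j < Ny) width X i.*2.+1 * width Y j.*2.+1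
      * u i.*2.+1 j.*2.+1 * d_x X phi i.*2.+1 j.*2.+1.
Proof.
move=> phi0; rewrite inner_TM_columns exchange_big_nat -sumrN.
apply: eq_big_nat => j /andP[_ ltj]; have [phi_l phi_r] := phi0 j ltj.
have := sum_by_parts_node _ _ _ Lx_gt0 partX (u^~ j.*2.+1) (phi^~ j.*2.+1).
rewrite /D_x => ->; rewrite phi_l phi_r !mulr0 subrr sub0r mulrN mulr_sumr.
by congr (- _); apply: eq_bigr => i _; rewrite /d_x; ring.
Qed.

Lemma inner_TM_d_y u phi :
  (forall i, (i <= Nx)%N -> phi i.*2 0%N = 0 /\ phi i.*2 Ny.*2 = 0) ->
  inner_TM X Y (d_y Y u) phi =
  - \sum_(1 <= i < Nx) \sum_(0 <= j < Ny.+1) width X i.*2 * width Y j.*2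
      * u i.*2 j.*2 * D_y Y phi i.*2 j.*2.
Proof.
move=> phi0; rewrite inner_TM_rows -sumrN.
apply: eq_big_nat => i /andP[_ /ltnW lti]; have [phi_l phi_r] := phi0 i lti.
have := sum_by_parts_mid _ _ _ Ly_gt0 partY (u i.*2) (phi i.*2).
rewrite /d_y => ->; rewrite phi_l phi_r !mulr0 subrr sub0r mulrN mulr_sumr.
by congr (- _); apply: eq_bigr => j _; rewrite /D_y; ring.
Qed.

(** Pointwise the two sides differ by a positive weight times [(v - u) ^+ 2 / 2]. *)
Lemma inner_TM_sqr_sub_le u v :
  2^-1 * inner_TM X Y v v - 2^-1 * inner_TM X Y u u
    <= inner_TM X Y v v - inner_TM X Y u v.
Proof.
rewrite /inner_TM !mulr_sumr -!sumrB.
apply: ler_sum_nat => i /andP[_ lti]; rewrite !mulr_sumr -!sumrB.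
apply: ler_sum_nat => j /andP[_ ltj].
rewrite -subr_ge0.
set a := v _ _; set b := u _ _; set w := width X _ * _.
have -> : w * a * a - w * b * a - (2^-1 * (w * a * a) - 2^-1 * (w * b * b))
  = w * (a - b) ^+ 2 / 2 by field.
have w0 : 0 <= w.
  apply: mulr_ge0; first exact/ltW/(width_node_gt0 _ _ _ Lx_gt0 partX)/ltnW.
  exact/ltW/(width_mid_gt0 _ _ _ partY).
by rewrite divr_ge0 // mulr_ge0 // sqr_ge0.
Qed.

Lemma normsq_M_ge0 f : 0 <= normsq_M X Y f.
Proof.
rewrite /normsq_M big_nat sumr_ge0 // => i /andP[_ lti].
rewrite big_nat sumr_ge0 // => j /andP[_ ltj].
rewrite mulr_ge0 ?sqr_ge0 // mulr_ge0 // ltW //.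
  exact: width_mid_gt0 partX _ lti.
exact: width_mid_gt0 partY _ ltj.
Qed.

Lemma normsq_Ty_ge0 f : 0 <= normsq_Ty X Y f.
Proof.
rewrite /normsq_Ty big_nat sumr_ge0 // => i /andP[_ lti].
rewrite big_nat sumr_ge0 // => j /andP[_ ltj].
rewrite mulr_ge0 ?sqr_ge0 // mulr_ge0 // ltW //.
  exact: width_node_gt0 Lx_gt0 partX _ (ltnW lti).
exact: width_node_gt0 Ly_gt0 partY _ ltj.
Qed.

(** * One unforced time step of a single component, from [v0] to [v] with pressure [z] *)

Section Step.
Variables (mu dt : R) (v0 v z : nat -> nat -> R).
Hypothesis step : forall i j, (0 < i < Nx)%N -> (j < Ny)%N ->
  v i.*2 j.*2.+1 - v0 i.*2 j.*2.+1 =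
  dt * (mu * (D_x X (d_x X v) i.*2 j.*2.+1 + d_y Y (D_y Y v) i.*2 j.*2.+1)
        - D_x X z i.*2 j.*2.+1).

Lemma inner_TM_step phi :
  inner_TM X Y v phi - inner_TM X Y v0 phi =
  dt * (mu * (inner_TM X Y (D_x X (d_x X v)) phi
              + inner_TM X Y (d_y Y (D_y Y v)) phi)
        - inner_TM X Y (D_x X z) phi).
Proof.
rewrite /inner_TM -big_split mulr_sumr -!sumrB mulr_sumr /=.
apply: eq_big_nat => i lti.
rewrite -big_split mulr_sumr -!sumrB mulr_sumr /=.
apply: eq_big_nat => j /andP[_ ltj].
by rewrite -mulrBl -mulrBr step //; ring.
Qed.

(** Test with [phi := v]. The work of the pressure is kept on the right, to be cancelled later
    against that of the other component. *)
Lemma energy_step :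
  (forall j, (j < Ny)%N -> v 0%N j.*2.+1 = 0 /\ v Nx.*2 j.*2.+1 = 0) ->
  (forall i, (i <= Nx)%N -> v i.*2 0%N = 0 /\ v i.*2 Ny.*2 = 0) ->
  2^-1 * inner_TM X Y v v - 2^-1 * inner_TM X Y v0 v0 <=
  - (dt * mu * (normsq_M X Y (d_x X v) + normsq_Ty X Y (D_y Y v)))
  + dt * \sum_(0 <= i < Nx) \sum_(0 <= j < Ny)
      width X i.*2.+1 * width Y j.*2.+1
      * z i.*2.+1 j.*2.+1 * d_x X v i.*2.+1 j.*2.+1.
Proof.
move=> vx vy; apply: le_trans (inner_TM_sqr_sub_le _ _) _.
rewrite inner_TM_step !inner_TM_D_x // inner_TM_d_y //.
(* The inequality was spent on the squares; what remains is an equality. *)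
rewrite le_eqVlt; apply/predU1l.
have -> : normsq_M X Y (d_x X v) = \sum_(0 <= i < Nx) \sum_(0 <= j < Ny)
    width X i.*2.+1 * width Y j.*2.+1
    * d_x X v i.*2.+1 j.*2.+1 * d_x X v i.*2.+1 j.*2.+1.
  by apply: eq_bigr => i _; apply: eq_bigr => j _; rewrite expr2 mulrA.
have -> : normsq_Ty X Y (D_y Y v) = \sum_(1 <= i < Nx) \sum_(0 <= j < Ny.+1)
    width X i.*2 * width Y j.*2 * D_y Y v i.*2 j.*2 * D_y Y v i.*2 j.*2.
  by apply: eq_bigr => i _; apply: eq_bigr => j _; rewrite expr2 mulrA.
ring.
Qed.

(** The test function depends on y alone, so the pressure and the x-viscosity see a constant, while
    the y-viscosity sees a constant slope [c]. The constant 1 has [c = 0] and the coordinate y has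
    [c = 1]. *)
Lemma moment_step (phi : nat -> R) (c : R) :
  (forall j, (j <= Ny)%N -> diff_node Y phi j.*2 = c) ->
  (forall p j, p \in [:: 0; 2; Nx.*2.-2; Nx.*2]%N -> (j < Ny)%N ->
     v p j.*2.+1 = 0) ->
  (forall i q, (i <= Nx)%N -> q \in [:: 0; 1; Ny.*2.-1; Ny.*2]%N ->
     v i.*2 q = 0) ->
  (forall p j, p \in [:: 1; Nx.*2.-1]%N -> (j < Ny)%N -> z p j.*2.+1 = 0) ->
  inner_TM X Y v (fun _ => phi) = inner_TM X Y v0 (fun _ => phi).
Proof.
move=> phic vx vy zx; apply/eqP; rewrite -subr_eq0 inner_TM_step; apply/eqP.
have Dx0 u : (forall p j, p \in [:: 1; Nx.*2.-1]%N -> (j < Ny)%N ->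
    u p j.*2.+1 = 0) -> inner_TM X Y (D_x X u) (fun _ => phi) = 0.
  move=> u0; rewrite inner_TM_columns big_nat big1 // => j /andP[_ ltj].
  rewrite /D_x.
  have := sum_diff_node _ _ _ Lx_gt0 partX (u^~ j.*2.+1)
    (fun=> phi j.*2.+1).
  by move=> ->; rewrite ?mulr0 // ?u0 // ?inE ?eqxx ?orbT // => p;
    rewrite diff_mid_cst.
rewrite !Dx0 // => [|p j pin ltj].
  rewrite add0r subr0 inner_TM_rows big_nat big1 ?mulr0 // => i /andP[_ lti].
  have := sum_diff_mid_diff_node _ _ _ Ly_gt0 partY (v i.*2) phi c.
  rewrite /d_y /D_y => ->; rewrite ?mulr0 //; apply: vy;
    by rewrite ?(ltnW lti) // !inE ?eqxx ?orbT.
(* In an outermost cell both neighbouring nodes lie where [v] vanishes, hence so does [d_x v]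
   there. *)
have vp : v p.-1 j.*2.+1 = 0 /\ v p.+1 j.*2.+1 = 0.
  have n0 := ncells_gt0 _ _ _ Lx_gt0 partX.
  split; apply: vx; rewrite // !inE; move: pin; rewrite !inE; lia.
by rewrite /d_x /diff_mid; case: vp => -> ->; rewrite subrr mul0r.
Qed.

End Step.
End XComponent.

(** * Transposition of the grid *)

Section ExchangeAxes.
Variables (R : realType) (X Y : axis R).
Implicit Types f g : nat -> nat -> R.

Lemma inner_MT_exchange f g :
  inner_MT X Y f g = inner_TM Y X (fun q p => f p q) (fun q p => g p q).
Proof.
rewrite /inner_MT exchange_big_nat.
by apply: eq_bigr => i _; apply: eq_bigr => j _; rewrite [width X _ * _]mulrC.
Qed.

Lemma normsq_M_exchange f : normsq_M X Y f = normsq_M Y X (fun q p => f p q).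
Proof.
rewrite /normsq_M exchange_big_nat.
by apply: eq_bigr => i _; apply: eq_bigr => j _; rewrite [width X _ * _]mulrC.
Qed.

Lemma normsq_Tx_exchange f : normsq_Tx X Y f = normsq_Ty Y X (fun q p => f p q).
Proof.
rewrite /normsq_Tx exchange_big_nat.
by apply: eq_bigr => i _; apply: eq_bigr => j _; rewrite [width X _ * _]mulrC.
Qed.

End ExchangeAxes.

(** * Removal of the force and assembly of the two components *)

Lemma Rintegral_eq0 (R : realType) (a b : R) (g : R -> R) :
  (forall s, s \in `[a, b] -> g s = 0) ->
  \int[lebesgue_measure]_(s in `[a, b]%classic) g s = 0.
Proof. by move=> g0; rewrite /Rintegral integral0_eq // => s /g0 ->. Qed.

Theorem theorem10 (R : realType) (Lx Ly T mu C0 : R) (N : nat) (X Y : axis R)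
    (gx gy : R -> R -> R -> R) (Wx Wy Z : nat -> nat -> nat -> R) :
  0 < Lx -> 0 < Ly -> 0 < T -> 0 < mu -> 0 < C0 -> (0 < N)%N ->
  partition_of X Lx -> partition_of Y Ly -> regular_mesh X Y C0 ->
  let dt := T / N%:R in
  let W := fun n : nat => (Wx n, Wy n) in
  RMAC_solution X Y mu dt N gx gy Wx Wy Z ->
  (forall n i j : nat,
     (1 <= n <= N)%N -> (i < ncells X)%N -> (j < ncells Y)%N ->
     d_x X (Wx n) i.*2.+1 j.*2.+1 + d_y Y (Wy n) i.*2.+1 j.*2.+1 = 0)
  /\
  (no_force Lx Ly T gx gy ->
     (forall n : nat, (1 <= n <= N)%N ->
        2^-1 * normsq X Y (W n) - 2^-1 * normsq X Y (W n.-1)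
          <= - (dt * mu * normsq_D X Y (W n))
        /\ - (dt * mu * normsq_D X Y (W n)) <= 0)
     /\
     (compact_support X Y N Wx Wy Z ->
        forall n : nat, (1 <= n <= N)%N ->
          [/\ inner X Y (W n) (e1 R) = inner X Y (W n.-1) (e1 R),
              inner X Y (W n) (e2 R) = inner X Y (W n.-1) (e2 R) &
              inner X Y (W n) (xhat X Y) = inner X Y (W n.-1) (xhat X Y)])).
Proof.
move=> Lx0 Ly0 T0 mu0 _ N0 partX partY _ dt W [eqx eqy eqm slip].
have dt0 : 0 < dt by rewrite divr_gt0 // ltr0n.
split=> [n i j ln li lj|nof]; first exact: eqm.
(* The time levels of the scheme lie in the range covered by [no_force]. *)
have tn n : (0 < n <= N)%N -> 0 < n%:R * dt <= T.
  move=> /andP[n0 nN]; rewrite mulr_gt0 ?ltr0n //= /dt mulrCA.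
  by rewrite ger_pMr // ler_pdivrMr ?ltr0n // mul1r ler_nat.
have stepx n : (0 < n <= N)%N -> forall i j, (0 < i < ncells X)%N ->
    (j < ncells Y)%N -> Wx n i.*2 j.*2.+1 - Wx n.-1 i.*2 j.*2.+1 =
    dt * (mu * (D_x X (d_x X (Wx n)) i.*2 j.*2.+1
                + d_y Y (D_y Y (Wx n)) i.*2 j.*2.+1)
          - D_x X (Z n) i.*2 j.*2.+1).
  move=> ln i j li lj; have := eqx n i j ln li lj; rewrite /momentum_x_eq.
  have -> : force_x X Y dt gx n i.*2 j.*2.+1 = 0.
    case/andP: li => i0 li.
    rewrite /force_x Rintegral_eq0 ?mul0r // => s; rewrite in_itv /=.
    (* Since [0 < i], both limits of integration are midpoints of cells, so the interval stays
       inside the open domain. *)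
    have -> : i.*2.-1 = i.-1.*2.+1 by lia.
    have := node_mid_itv _ _ _ partX i.-1 ltac:(lia).
    have := node_mid_itv _ _ _ partX i li.
    have := node_mid_itv _ _ _ partY j lj.
    move=> yj xi xi1 ls.
    have [|//] := nof s (node Y j.*2.+1) (n%:R * dt) _ yj (tn n ln).
    by lra.
  rewrite /d_t => E; rewrite -[LHS](divfK (lt0r_neq0 dt0)) mulrC; congr (_ * _).
  by move: E; lra.
(* Indices and viscous terms are ordered as [step] requires after exchanging the axes. *)
have stepy n : (0 < n <= N)%N -> forall j i, (0 < j < ncells Y)%N ->
    (i < ncells X)%N -> Wy n i.*2.+1 j.*2 - Wy n.-1 i.*2.+1 j.*2 =
    dt * (mu * (D_y Y (d_y Y (Wy n)) i.*2.+1 j.*2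
                + d_x X (D_x X (Wy n)) i.*2.+1 j.*2)
          - D_y Y (Z n) i.*2.+1 j.*2).
  move=> ln j i lj li; have := eqy n i j ln li lj; rewrite /momentum_y_eq.
  have -> : force_y X Y dt gy n i.*2.+1 j.*2 = 0.
    case/andP: lj => j0 lj.
    rewrite /force_y Rintegral_eq0 ?mul0r // => s; rewrite in_itv /=.
    have -> : j.*2.-1 = j.-1.*2.+1 by lia.
    have := node_mid_itv _ _ _ partY j.-1 ltac:(lia).
    have := node_mid_itv _ _ _ partY j lj.
    have := node_mid_itv _ _ _ partX i li.
    move=> xi yj yj1 ls.
    have [|//] := nof (node X i.*2.+1) s (n%:R * dt) xi _ (tn n ln).
    by lra.
  rewrite /d_t => E; rewrite -[LHS](divfK (lt0r_neq0 dt0)) mulrC; congr (_ * _).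
  by move: E; lra.
split=> [n ln|supp n ln].
  have [_ nN] := andP ln.
  have [slipx1 slipx2 slipy1 slipy2] := slip n nN.
  have := energy_step _ X Y _ _ Lx0 Ly0 partX partY _ _ _ _ _ (stepx n ln)
    slipx1 slipx2.
  have := energy_step _ Y X _ _ Ly0 Lx0 partY partX mu dt
    (fun q p => Wy n.-1 p q) (fun q p => Wy n p q) (fun q p => Z n p q)
    (stepy n ln) slipy2 slipy1.
  set Px := \sum_(0 <= i < ncells X) _; set Py := \sum_(0 <= i < ncells Y) _.
  (* Cell by cell, the two works add up to a weight times [Z] times the discrete divergence. *)
  have P0 : Px + Py = 0.
    rewrite /Py exchange_big_nat -big_split big_nat big1 // => i /andP[_ li].
    rewrite -big_split big_nat big1 // => j /andP[_ lj] /=.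
    rewrite [width Y _ * _]mulrC -mulrDr.
    have := eqm n i j ln li lj; rewrite /mass_eq => E.
    by rewrite [X in _ * X]E mulr0.
  have Pyx : Py = - Px by apply/eqP; rewrite -addr_eq0 addrC P0.
  rewrite Pyx mulrN.
  rewrite /normsq /inner /normsq_D /= !inner_MT_exchange.
  rewrite (normsq_M_exchange _ X Y (d_y Y _)) normsq_Tx_exchange.
  have := normsq_M_ge0 _ X Y _ _ partX partY (d_x X (Wx n)).
  have := normsq_Ty_ge0 _ X Y _ _ Lx0 Ly0 partX partY (D_y Y (Wx n)).
  have := normsq_M_ge0 _ Y X _ _ partY partX (fun q p => d_y Y (Wy n) p q).
  have := normsq_Ty_ge0 _ Y X _ _ Ly0 Lx0 partY partX
    (fun q p => D_x X (Wy n) p q).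
  move=> D1 D2 D3 D4 Ey Ex; split; last first.
    by rewrite oppr_le0 mulr_ge0 ?mulr_ge0 ?addr_ge0 // ltW.
  by move: Ex Ey; rewrite /d_x /d_y /D_x /D_y; lra.
have [_ nN] := andP ln.
have [[cx1 cx2] [cy1 cy2]] := supp.1 n nN.
have [cz1 cz2] := supp.2 n ln.
have mx := moment_step _ X Y _ _ Lx0 Ly0 partX partY _ _ _ _ _ (stepx n ln).
have my := moment_step _ Y X _ _ Ly0 Lx0 partY partX mu dt
  (fun q p => Wy n.-1 p q) (fun q p => Wy n p q) (fun q p => Z n p q)
  (stepy n ln).
have {}mx phi c : (forall j, (j <= ncells Y)%N -> diff_node Y phi j.*2 = c) ->
    inner_TM X Y (Wx n) (fun _ => phi) = inner_TM X Y (Wx n.-1) (fun _ => phi).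
  move=> phic; apply: (mx phi c) => // p j; rewrite !inE => pin lj.
  (* The doubled indices 0, 2, [Nx.*2.-2], [Nx.*2] are the nodes 0, 1, [Nx.-1], [Nx] of the support
     condition. *)
  have [i -> iin] :
      exists2 i, p = i.*2 & i \in [:: 0; 1; (ncells X).-1; ncells X]%N.
    by exists p./2; rewrite ?inE; lia.
  exact: cx1.
have {}my phi c : (forall i, (i <= ncells X)%N -> diff_node X phi i.*2 = c) ->
    inner_MT X Y (Wy n) (fun p _ => phi p)
    = inner_MT X Y (Wy n.-1) (fun p _ => phi p).
  move=> phic; rewrite !inner_MT_exchange.
  apply: (my phi c) => // [q i|j p lj pin|q i qin li].
  - rewrite !inE => qin li.
    have [j -> jin] :
        exists2 j, q = j.*2 & j \in [:: 0; 1; (ncells Y).-1; ncells Y]%N.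
      by exists q./2; rewrite ?inE; lia.
    exact: cy2.
  - exact: cy1.
  - exact: cz2.
(* The constants give linear momentum. The coordinates show that the two halves of the angular
   momentum, [Wx] against y and [Wy] against x, are conserved separately. *)
have one_x := mx (fun=> 1) 0 (fun _ _ => diff_node_cst _ _ _ _).
have one_y := my (fun=> 1) 0 (fun _ _ => diff_node_cst _ _ _ _).
have node_x := mx _ 1 (diff_node_node _ _ _ Ly0 partY).
have node_y := my _ 1 (diff_node_node _ _ _ Lx0 partX).
have MT0 f : inner_MT X Y f (fun _ _ => 0) = 0.
  by rewrite /inner_MT big1 // => i _; rewrite big1 // => j _; rewrite mulr0.
have TM0 f : inner_TM X Y f (fun _ _ => 0) = 0.
  by rewrite /inner_TM big1 // => i _; rewrite big1 // => j _; rewrite mulr0.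
have MTN f g : inner_MT X Y f (fun p q => - g p q) = - inner_MT X Y f g.
  rewrite /inner_MT -sumrN; apply: eq_bigr => i _.
  by rewrite -sumrN; apply: eq_bigr => j _; rewrite mulrN.
rewrite /inner /=; split.
- by rewrite !MT0 one_x.
- by rewrite !TM0 one_y.
- by rewrite node_x !(MTN _ (fun p _ => node X p)) node_y.
Qed.
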